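(* Fix $d\in\mathbb N$ and $\alpha_1,\alpha_2,\dots,\alpha_d\in\mathbb R$ such that $1,\alpha_1,\alpha_2,\dots,\alpha_d$ are $\mathbb Q$-linearly independent. For every $i$ with $1\le i\le d$, let $\mathbf a^{(i)}$ be the (Sturmian) word defined by $a^{(i)}_n=\lfloor n\alpha_i\rfloor-\lfloor (n-1)\alpha_i\rfloor$ for $n\in\mathbb N_0$, and let $\mathbf a=\prod_{i=1}^d\mathbf a^{(i)}$ be the product word, $a_n=(a^{(1)}_n,a^{(2)}_n,\dots,a^{(d)}_n)$. Then $\mathbf a$ is a bracket word and $\lambda(\mathbf a)=d$.
   Context: $\mathbb N=\{1,2,\dots\}$ and $\mathbb N_0=\mathbb N\cup\{0\}$. Generalised polynomial (GP) maps $\mathbb R\to\mathbb R$ form the smallest family of maps that contains all polynomial maps $\mathbb R\to\mathbb R$, is closed under sums and products, and contains $\lfloor g\rfloor$ whenever it contains $g$. A GP map $\mathbb N_0\to\mathbb R$ is the restriction to $\mathbb N_0$ of such a map. A bracket word over a finite alphabet $\Sigma$ is an infinite word $\mathbf a=(a_n)_{n=0}^\infty\in\Sigma^\infty$ of the form $a_n=c(g(n))$ for all $n\in\mathbb N_0$, where $g\colon\mathbb N_0\to\mathbb R$ is a finitely-valued GP map and $c\colon g(\mathbb N_0)\to\Sigma$ is an arbitrary map. The subword complexity is $p_{\mathbf a}(N)=|\{a_na_{n+1}\cdots a_{n+N-1}: n\in\mathbb N_0\}|$, and $\lambda(\mathbf a)=\limsup_{N\to\infty}\dfrac{\log p_{\mathbf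 a}(N)}{\log N}$. *)

(* Defs.v *)
From HB Require Import structures.
From mathcomp Require Import all_boot all_order all_algebra finmap.
From mathcomp Require Import all_classical all_reals all_analysis.

Set Implicit Arguments.
Unset Strict Implicit.
Unset Printing Implicit Defensive.

Import Order.TTheory GRing.Theory Num.Theory.

Local Open Scope classical_set_scope.
Local Open Scope ring_scope.

Inductive GP (R : realType) : (R -> R) -> Prop :=
| GP_poly (p : {poly R}) : GP (fun x => p.[x])
| GP_add (g h : R -> R) : GP g -> GP h -> GP (fun x => g x + h x)
| GP_mul (g h : R -> R) : GP g -> GP h -> GP (fun x => g x * h x)
| GP_floor (g : R -> R) : GP g -> GP (fun x => (Num.floor (g x))%:~R).

Definition GP_nat (R : realType) (g : nat -> R) : Prop :=
  exists2 f : R -> R, GP f & forall n : nat, g n = f n%:R.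

(* The alphabet is a finite subset Sigma of the ambient type T.  The map c is
   only used on the values of g; outside of them it is unconstrained. *)
Definition bracket_word_over (R : realType) (T : Type) (Sigma : set T)
    (a : nat -> T) : Prop :=
  exists (g : nat -> R) (c : R -> T),
    [/\ GP_nat g,
        finite_set (range g),
        forall x, range g x -> Sigma (c x)
      & forall n, a n = c (g n)].

Definition bracket_word (R : realType) (T : Type) (a : nat -> T) : Prop :=
  exists2 Sigma : set T, finite_set Sigma & bracket_word_over R Sigma a.

Definition factor (T : Type) (a : nat -> T) (N n : nat) : N.-tuple T :=
  [tuple a (n + i)%N | i < N].

(* fset_set sends an infinite set to the empty one; for a word over a finite
   alphabet the set of factors of a given length is always finite. *)
Definition subword_complexity (T : choiceType) (a : nat -> T) (N : nat) : nat :=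
  #|` fset_set (range (factor a N)) |.

(* The terms of index N = 0 and N = 1, where ln N is 0, do not affect the
   limit superior. *)
Definition lambda (R : realType) (T : choiceType) (a : nat -> T) : \bar R :=
  limn_esup (fun N : nat =>
    (ln (subword_complexity a N)%:R / ln N%:R : R)%:E).

Definition Q_linearly_independent (R : realType) (I : finType) (x : I -> R)
    : Prop :=
  forall q : I -> rat, \sum_(i : I) ratr (q i) * x i = 0 -> forall i, q i = 0.

(* The difference n - 1 is taken in R, so that n = 0 gives - floor (- alpha). *)
Definition sturmian (R : realType) (alpha : R) (n : nat) : int :=
  Num.floor (n%:R * alpha) - Num.floor ((n%:R - 1) * alpha).

Definition product_word (d : nat) (T : Type) (a : 'I_d -> nat -> T) (n : nat)
    : {ffun 'I_d -> T} :=
  [ffun i => a i n].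

(* Main.v *)
Require Import Defs.
From HB Require Import structures.
From mathcomp Require Import all_boot all_order all_algebra finmap.
From mathcomp Require Import all_classical all_reals all_analysis.
From mathcomp Require Import ring lra zify.

Set Implicit Arguments.
Unset Strict Implicit.
Unset Printing Implicit Defensive.

Import Order.TTheory GRing.Theory Num.Theory.
Import numFieldNormedType.Exports.

Local Open Scope classical_set_scope.
Local Open Scope ring_scope.

(** The complexity is computed exactly: the product word has (N + 1) ^ d
    factors of length N, so that ln p(N) / ln N = d * ln (N + 1) / ln N tends
    to d and the limit superior is a limit.

    A factor of length N of one Sturmian word, read from position n, carries
    the same information as its partial sums, the heights
      floor (z + k * alpha) - floor z   with z = (n - 1) * alpha, k <= N.
    They depend only on the fractional part f of z, they take the values
    floor (k * alpha) or floor (k * alpha) + 1, and they are monotone in f.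
    Hence the set of the k in 1..N where the larger value is taken grows with
    f and is determined by its cardinal, which leaves at most N + 1 factors
    ([eq_height_jumps]) and at most (N + 1) ^ d factors for the product.

    Conversely, for k in 0..N consider the positions n with z + k * alpha
    slightly above an integer, that is, f slightly above a discontinuity of
    the k-th height. If slightly means closer than any j * alpha with
    0 < j <= N is to an integer, then distinct k give distinct factors
    ([height_separation]). By Kronecker's theorem ([kronecker]) the d
    conditions, with an independent choice of k for each alpha_i, can be met
    at the same n, so all (N + 1) ^ d combinations occur.

    Kronecker's theorem is proved by induction on the dimension. The pigeonhole
    principle gives a nonzero short vector phi = q * theta - b with b integral.
    Projecting along phi kills one coordinate; the projected problem is
    Kronecker's theorem for the ratios of the coordinates of phi, which are
    again independent. A projected solution is a point close to the line
    beta + R phi, and adding an integer multiple of phi brings it close to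
    beta, because phi is short.

    That the word is a bracket word is witnessed by the generalised polynomial
    n |-> sum_i alpha_i * a^(i)_n: by independence its value determines the
    letter a_n. *)

(** * Counting the values of a sequence *)

Lemma finite_range_code (F : finType) (T : Type) (w : nat -> T)
    (code : nat -> F) :
    (forall n m, code n = code m -> w n = w m) ->
  exists h : F -> T, forall n, w n = h (code n).
Proof.
move=> wP; exists (fun f => w (xget 0%N [set n | code n = f])) => n.
by apply/wP/esym; apply: (@xgetPex _ 0%N [set m | code m = code n]); exists n.
Qed.

Lemma card_range_le (F : finType) (T : choiceType) (w : nat -> T)
    (code : nat -> F) :
    (forall n m, code n = code m -> w n = w m) ->
  finite_set (range w) /\ (#|` fset_set (range w)| <= #|F|)%N.
Proof.
move=> /finite_range_code[h hP].
have fin : finite_set (range w).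
  apply: (@sub_finite_set _ _ (range h)); last exact/finite_image/finite_finset.
  by move=> _ [n _ <-]; rewrite hP; exists (code n).
split=> //; rewrite cardE -(size_map h); apply: uniq_leq_size => // x.
rewrite in_fset_set // inE => -[n _ <-]; rewrite hP.
by apply: map_f; rewrite mem_enum.
Qed.

Lemma card_range_ge (F : finType) (T : choiceType) (w : nat -> T)
    (v : F -> nat) :
    finite_set (range w) -> injective (w \o v) ->
  (#|F| <= #|` fset_set (range w)|)%N.
Proof.
move=> fin inj; rewrite cardE -(size_map (w \o v)); apply: uniq_leq_size.
  by rewrite (map_inj_uniq inj) enum_uniq.
by move=> _ /mapP[f _ ->]; rewrite in_fset_set // inE; exists (v f).
Qed.

(** * Simultaneous approximation *)

(** Linear independence of 1, theta_0, ..., theta_(d-1) over the integers. The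
    conclusion c0 = 0 follows from the others, and c0 is the coefficient that
    absorbs the integral translations of the torus. *)
Definition Z_independent (R : realType) (d : nat) (theta : 'I_d -> R) : Prop :=
  forall (c0 : int) (c : 'I_d -> int),
    c0%:~R + \sum_i (c i)%:~R * theta i = 0 -> forall i, c i = 0.

Lemma Q_independent_Z (R : realType) (d : nat) (alpha : 'I_d -> R) :
  Q_linearly_independent (oapp alpha 1) -> Z_independent alpha.
Proof.
move=> ind c0 c sum0 i.
have E (x : int) : ratr x%:~R = x%:~R :> R by rewrite ratr_int.
pose q (o : option 'I_d) : rat := if o is Some i then (c i)%:~R else c0%:~R.
suff /ind/(_ (Some i))/eqP : \sum_o ratr (q o) * oapp alpha 1 o = 0.
  by rewrite /= intr_eq0 => /eqP.
rewrite (bigD1 None) //= E mulr1 -[RHS]sum0; congr (_ + _).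
rewrite (reindex_omap Some id) => [|[]//].
rewrite (eq_bigl xpredT) => [|j]; last by rewrite /= eqxx.
by apply: eq_bigr => j _; rewrite E.
Qed.

(** Pigeonhole on a grid of mesh 1 / K < e: among the multiples of L.+1 two
    have all their fractional parts in the same cell, and q is their
    difference. The lower bound L on q makes it possible to turn a negative
    time into a positive one in [kronecker]. *)
Lemma simultaneous_return (R : realType) (I : finType) (theta : I -> R)
    (e : R) (L : nat) : 0 < e ->
  exists (q : nat) (b : I -> int),
    (L < q)%N /\ forall i, `|q%:R * theta i - (b i)%:~R| < e.
Proof.
move=> e0; pose K := Num.truncn e^-1.
have Ke : K.+1%:R^-1 < e by rewrite invf_plt ?posrE ?ltr0n// truncnS_gt.
pose x (n : nat) i := (n * L.+1)%:R * theta i.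
pose u n i := x n i - (Num.floor (x n i))%:~R.
have u01 n i : 0 <= u n i < 1.
  by have := floor_itv (x n i); rewrite /u intrD1; lra.
have K0 : (0 : R) < K.+1%:R by rewrite ltr0n.
have uK n i : 0 <= Num.floor (K.+1%:R * u n i) < K.+1%:Z.
  rewrite floor_ge0 floor_lt_int; have := u01 n i; nra.
pose code (n : nat) : {ffun I -> 'I_K.+1} :=
  [ffun i => inord `|Num.floor (K.+1%:R * u n i)|].
(* one more multiple than there are cells *)
have /injectivePn[n [m nm] cnm] :
    ~~ injectiveb (fun n : 'I_#|{ffun I -> 'I_K.+1}|.+1 => code n).
  apply/negP => /injectiveP/leq_card; by rewrite card_ord ltnn.
wlog ltnm : n m nm cnm / (n < m)%N.
  move=> H; have := nm; rewrite -val_eqE neq_ltn => /orP[/H|/H]; first exact.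
  by apply; rewrite // eq_sym.
exists ((m - n) * L.+1)%N.
exists (fun i => Num.floor (x m i) - Num.floor (x n i)); split.
  by rewrite (@leq_pmull L.+1) // subn_gt0.
move=> i; apply: lt_trans Ke.
have -> : ((m - n) * L.+1)%:R * theta i
    - (Num.floor (x m i) - Num.floor (x n i))%:~R = u m i - u n i.
  by rewrite /u /x mulnBl natrB ?leq_mul2r ?(ltnW ltnm) ?orbT// intrB; ring.
have /(congr1 val) := congr1 (fun f : {ffun _} => f i) cnm; rewrite !ffunE /=.
have bnd k : (`|Num.floor (K.+1%:R * u k i)| < K.+1)%N.
  by have /andP[? ?] := uK k i; rewrite -ltz_nat gez0_abs.
rewrite !inordK // => /(congr1 Posz); rewrite !gez0_abs; last first.
- by case/andP: (uK n i).
- by case/andP: (uK m i).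
move=> fl; have := floor_itv (K.+1%:R * u n i).
have := floor_itv (K.+1%:R * u m i); rewrite -fl !intrD1 => H1 H2.
rewrite -(ltr_pM2l K0) divff ?gt_eqF// -[X in X * _]gtr0_norm // -normrM.
by rewrite ltr_norml; lra.
Qed.

(** Induction on d, projecting along a short vector phi of the group
    Z theta + Z^d. The first coordinate is eliminated, so that the ratios
    theta' = phi_j / phi_0 generate the projection of Z^d.+1 together with
    Z^d. *)
Lemma kronecker_int (R : realType) (d : nat) (theta : 'I_d -> R) :
    Z_independent theta ->
  forall (beta : 'I_d -> R) (e : R), 0 < e ->
  exists (n : int) (p : 'I_d -> int),
    forall i, `|n%:~R * theta i - (p i)%:~R - beta i| < e.
Proof.
elim: d theta => [|d IHd] theta ind beta e e0.
  by exists 0, (fun=> 0) => -[].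
have e20 : 0 < e / 2 by rewrite divr_gt0.
have [q [b [q0 phi_lt]]] := simultaneous_return theta 0 e20.
pose phi i := q%:R * theta i - (b i)%:~R.
have phi_ind (c : 'I_d.+1 -> int) :
    \sum_i (c i)%:~R * phi i = 0 -> forall i, c i = 0.
  move=> sum0 i.
  suff /(_ i)/eqP : forall i, c i * q%:Z = 0.
    by rewrite mulf_eq0 => /orP[/eqP//|/eqP[q00]]; rewrite q00 in q0.
  apply: (ind (- \sum_i c i * b i)); rewrite -[RHS]sum0 mulrNz rmorph_sum /=.
  rewrite -sumrN -big_split /=; apply: eq_bigr => j _.
  by rewrite !intrM /phi; ring.
have phi0 : phi ord0 != 0.
  apply/eqP => phi00.
  suff /phi_ind/(_ ord0) : \sum_i ((i == ord0)%:Z)%:~R * phi i = 0.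
    by rewrite eqxx.
  by rewrite big_ord_recl phi00 mulr0 add0r big1 // => j _; rewrite mul0r.
pose theta' (j : 'I_d) := phi (lift ord0 j) / phi ord0.
have theta'_ind : Z_independent theta'.
  move=> c0 c sum0 j.
  pose c' (i : 'I_d.+1) := oapp c c0 (unlift ord0 i).
  have := phi_ind c' _ (lift ord0 j); rewrite /c' liftK; apply.
  transitivity ((c0%:~R + \sum_i (c i)%:~R * theta' i) * phi ord0); last first.
    by rewrite sum0 mul0r.
  rewrite big_ord_recl unlift_none /= mulrDl.
  congr (_ + _); rewrite mulr_suml; apply: eq_bigr => k _.
  by rewrite liftK /= /theta' -!mulrA mulVf // mulr1.
have [p0 [p pP]] :=
  IHd theta' theta'_ind (fun j => beta (lift ord0 j) - beta ord0 * theta' j) _ e20.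
(* s * phi - p' is the point found; with t in place of s its first coordinate
   would be exactly beta_0, and rounding t costs at most |phi_i| < e / 2. *)
pose t := (beta ord0 + p0%:~R) / phi ord0; pose s := Num.floor t.
pose p' (i : 'I_d.+1) := oapp p p0 (unlift ord0 i).
exists (s * q%:Z), (fun i => s * b i + p' i) => i.
have -> : (s * q%:Z)%:~R * theta i - (s * b i + p' i)%:~R - beta i
    = (s%:~R - t) * phi i + (t * phi i - (p' i)%:~R - beta i).
  by rewrite intrD !intrM /phi; ring.
apply: le_lt_trans (ler_normD _ _) _; rewrite (splitr e).
apply: ltr_leD.
  apply: le_lt_trans (phi_lt i); rewrite normrM -/(phi i) ler_piMl //.
  by have := floor_itv t; rewrite -/s intrD1 ler_norml; lra.
case: (unliftP ord0 i) => [j ->|->]; rewrite /p' ?liftK ?unlift_none /=.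
  apply: ltW; rewrite (_ : _ - _ = p0%:~R * theta' j - (p j)%:~R
      - (beta (lift ord0 j) - beta ord0 * theta' j)); first exact: pP.
  by rewrite /t /theta'; field.
by rewrite /t divfK // [_ - _ - _](_ : _ = 0) ?normr0 ?ltW//; ring.
Qed.

(** The time n of [kronecker_int] may be negative; adding a return time
    q > |n| makes it positive and moves the point by less than e / 2. *)
Lemma kronecker (R : realType) (d : nat) (theta : 'I_d -> R) :
    Z_independent theta ->
  forall (beta : 'I_d -> R) (e : R), 0 < e ->
  exists (n : nat) (p : 'I_d -> int),
    forall i, `|n%:R * theta i - (p i)%:~R - beta i| < e.
Proof.
move=> ind beta e e0; have e20 : 0 < e / 2 by rewrite divr_gt0.
have [n [p pP]] := kronecker_int ind beta e20.
have [q [b [nq bP]]] := simultaneous_return theta `|n| e20.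
have nq0 : 0 <= n + q%:Z by lia.
exists `|(n + q%:Z)%R|%N, (fun i => p i + b i) => i.
rewrite natr_absz (ger0_norm nq0) !intrD -(pmulrn _ q).
have := bP i; have := pP i; rewrite !ltr_norml; lra.
Qed.

(** * Factors of Sturmian words *)

(** Since the letters are increments of n |-> floor (n * alpha), this is the
    sum of the k letters starting at position n. *)
Definition height (R : realType) (alpha : R) (n k : nat) : int :=
  Num.floor ((n%:R - 1) * alpha + k%:R * alpha)
  - Num.floor ((n%:R - 1) * alpha).

Lemma sturmian_height (R : realType) (alpha : R) (n k : nat) :
  sturmian alpha (n + k) = height alpha n k.+1 - height alpha n k.
Proof.
rewrite /height opprB addrA subrK /sturmian.
by congr (_ - _); congr Num.floor; rewrite natrD -?natr1; ring.
Qed.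

Lemma height0 (R : realType) (alpha : R) (n : nat) : height alpha n 0 = 0.
Proof. by rewrite /height mul0r addr0 subrr. Qed.

Lemma sturmian_eqP (R : realType) (alpha : R) (N n m : nat) :
  (forall k, (k < N)%N -> sturmian alpha (n + k) = sturmian alpha (m + k)) <->
  (forall k, (k <= N)%N -> height alpha n k = height alpha m k).
Proof.
split=> [eqs|eqh k ltkN]; last by rewrite !sturmian_height !eqh // ltnW.
elim=> [_|k IHk ltkN]; first by rewrite !height0.
have := eqs k ltkN; rewrite !sturmian_height IHk 1?ltnW //.
by move/addIr.
Qed.

Lemma eq_factorP (T : Type) (a : nat -> T) (N n m : nat) :
  Defs.factor a N n = Defs.factor a N m <->
  forall k, (k < N)%N -> a (n + k)%N = a (m + k)%N.
Proof.
split=> [eqf k ltkN|eqa]; last by apply: eq_mktuple => k; apply: eqa.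
have := congr1 (fun t => tnth t (Ordinal ltkN)) eqf.
by rewrite !tnth_mktuple.
Qed.

Lemma product_factor_eqP (R : realType) (d : nat) (alpha : 'I_d -> R)
    (N n m : nat) :
  let a := product_word (fun i => sturmian (alpha i)) in
  Defs.factor a N n = Defs.factor a N m <->
  forall i k, (k <= N)%N -> height (alpha i) n k = height (alpha i) m k.
Proof.
move=> a; split=> [/eq_factorP eqa i|eqh].
  apply/sturmian_eqP => k ltkN.
  by have /(congr1 (fun f : {ffun _} => f i)) := eqa k ltkN; rewrite !ffunE.
apply/eq_factorP => k ltkN; apply/ffunP => i; rewrite !ffunE.
by have /sturmian_eqP := eqh i; apply.
Qed.

(** * Upper bound: jumps are nested *)

Definition jump (R : realType) (alpha : R) (n k : nat) : bool :=
  Num.floor (k%:R * alpha) < height alpha n k.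

Lemma height_frac (R : realType) (alpha : R) (n k : nat) :
  let z := (n%:R - 1) * alpha in
  height alpha n k = Num.floor (z - (Num.floor z)%:~R + k%:R * alpha).
Proof.
move=> z; rewrite /height -/z [in RHS]addrAC -mulrNz.
by rewrite [in RHS]floorDrz ?intr_int // intrKfloor.
Qed.

(** The fractional part of z lies in [0, 1), so adding it to k * alpha raises
    the integer part by at most one. *)
Lemma height_jump (R : realType) (alpha : R) (n k : nat) :
  height alpha n k = Num.floor (k%:R * alpha) + (jump alpha n k)%:Z.
Proof.
rewrite /jump height_frac; set z := (_ - 1) * _.
set f := z - _; set x := k%:R * alpha.
have f01 : 0 <= f < 1.
  by have := floor_itv z; rewrite /f intrD1; lra.
have lo : Num.floor x <= Num.floor (f + x) by apply: le_floor; lra.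
have hi : Num.floor (f + x) < Num.floor x + 2.
  by rewrite floor_lt_int intrD; have := floor_itv x; rewrite intrD1; lra.
by case: ltP; lia.
Qed.

Lemma height_mono (R : realType) (alpha : R) (n m k : nat) :
  let z n := (n%:R - 1) * alpha in
  z n - (Num.floor (z n))%:~R <= z m - (Num.floor (z m))%:~R ->
  height alpha n k <= height alpha m k.
Proof. by move=> z le_nm; rewrite !height_frac le_floor // lerD2r. Qed.

(** The set of jumps is monotone in the fractional part of z, so two such sets
    are nested; having the same cardinal, they are equal. *)
Lemma eq_height_jumps (R : realType) (alpha : R) (N n m : nat) :
    (\sum_(k < N) jump alpha n k.+1 = \sum_(k < N) jump alpha m k.+1)%N ->
  forall k, (k <= N)%N -> height alpha n k = height alpha m k.
Proof.
pose z n := (n%:R - 1) * alpha.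
wlog le_nm : n m / z n - (Num.floor (z n))%:~R <= z m - (Num.floor (z m))%:~R.
  move=> H; case: (leP (z n - (Num.floor (z n))%:~R)
    (z m - (Num.floor (z m))%:~R)) => [/H//|/ltW/H{}H eqs k lekN].
  by rewrite (H _ k).
move=> eqs [|k] ltkN; first by rewrite !height0.
rewrite !height_jump; congr (_ + Posz _).
have /leqif_sum : forall k : 'I_N, xpredT k ->
    (jump alpha n k.+1 <= jump alpha m k.+1
      ?= iff (jump alpha n k.+1 == jump alpha m k.+1 :> nat))%N.
  move=> j _; split=> //; rewrite -lez_nat.
  by have := height_mono j.+1 le_nm; rewrite !height_jump lerD2l.
by case=> _ /esym; rewrite eqs eqxx => /forallP/(_ (Ordinal ltkN))/eqP.
Qed.

(** * Lower bound: all combinations of thresholds occur *)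

(** Write f, f' for the fractional parts of (n - 1) * alpha and
    (m - 1) * alpha, and u, u' for the two small quantities in the hypotheses.
    If all heights agree, evaluating at k forces f' >= f - u and evaluating at
    l forces f >= f' - u'. Modulo the integers (l - k) * alpha is
    u' - u + f - f', which then lies between - u and u', contradicting the
    gap unless k = l. *)
Lemma height_separation (R : realType) (alpha delta : R) (N n m k l : nat)
    (p q : int) :
    (forall j (r : int), (0 < j <= N)%N -> delta <= `|j%:R * alpha - r%:~R|) ->
    delta <= 1 -> (k <= N)%N -> (l <= N)%N ->
    0 < (n%:R - 1) * alpha + k%:R * alpha - p%:~R < delta ->
    0 < (m%:R - 1) * alpha + l%:R * alpha - q%:~R < delta ->
    (forall j, (j <= N)%N -> height alpha n j = height alpha m j) ->
  k = l.
Proof.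
move=> gap delta1 lekN lelN.
wlog ltkl : n m k l p q lekN lelN / (k < l)%N.
  move=> H zn zm eqh; case: (ltngtP k l) => // ltkl; first exact: (H n m k l p q).
  by apply/esym; apply: (H m n l k q p) => // j lejN; rewrite eqh.
move=> zn zm eqh; exfalso.
have := eqh k lekN; have := eqh l lelN; rewrite /height.
set y := (n%:R - 1) * alpha in zn *; set w := (m%:R - 1) * alpha in zm *.
have -> : Num.floor (y + k%:R * alpha) = p.
  by apply: floor_def; rewrite intrD1; lra.
have -> : Num.floor (w + l%:R * alpha) = q.
  by apply: floor_def; rewrite intrD1; lra.
move=> eql eqk.
have := floor_itv (y + l%:R * alpha); have := floor_itv (w + k%:R * alpha).
have -> : Num.floor (w + k%:R * alpha) = p - Num.floor y + Num.floor w by lia.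
have -> : Num.floor (y + l%:R * alpha) = q - Num.floor w + Num.floor y by lia.
have ltlkN : (0 < l - k <= N)%N by lia.
have := gap (l - k)%N (q - p + Num.floor y - Num.floor w) ltlkN.
rewrite natrB ?(ltnW ltkl) // !intrD1 !intrD !mulrNz => le_gap hk hl.
suff : `|(l%:R - k%:R) * alpha - (q%:~R - p%:~R + (Num.floor y)%:~R
    - (Num.floor w)%:~R)| < delta by rewrite ltNge le_gap.
by rewrite ltr_norml; lra.
Qed.

(** The minimum over i of the distances of x i to the nearest integers; the
    cap delta <= 1 is what lets a point within delta above an integer have
    that integer as its floor. *)
Lemma gap_exists (R : realType) (I : finType) (x : I -> R) :
    (forall i (p : int), x i != p%:~R) ->
  exists delta : R, [/\ 0 < delta, delta <= 1 &
    forall i (p : int), delta <= `|x i - p%:~R|].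
Proof.
move=> xnZ; pose u i := x i - (Num.floor (x i))%:~R.
have u01 i : 0 < u i < 1.
  have := floor_itv (x i); rewrite /u intrD1 => /andP[lo hi].
  by rewrite subr_gt0 lt_neqAle eq_sym xnZ lo /=; lra.
exists (\big[Num.min/1]_i Num.min (u i) (1 - u i)); split.
- by apply: lt_bigmin => // i _; rewrite lt_min; have := u01 i; lra.
- exact: bigmin_le_id.
move=> i p; apply: le_trans (bigmin_le 1 i _) _.
rewrite ge_min; apply/orP.
case: (leP p (Num.floor (x i))) => [lepx|ltxp].
  left; rewrite ler_normr; apply/orP; left; rewrite /u.
  by rewrite lerD2l lerN2 ler_int.
right; rewrite ler_normr; apply/orP; right; rewrite /u.
have : (Num.floor (x i) + 1)%:~R <= p%:~R :> R by rewrite ler_int; lia.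
by rewrite intrD1; lra.
Qed.

Lemma Z_independent_multiple (R : realType) (d : nat) (alpha : 'I_d -> R) :
  Z_independent alpha ->
  forall i j (p : int), (0 < j)%N -> j%:R * alpha i != p%:~R.
Proof.
move=> ind i j p j0; apply/eqP => jp.
suff /ind/(_ i)/eqP : (- p)%:~R
    + \sum_k ((if k == i then j else 0%N)%:Z)%:~R * alpha k = 0.
  by rewrite eqxx; lia.
rewrite (bigD1 i) //= eqxx big1 ?addr0 => [|k /negPf->]; last by rewrite mul0r.
by rewrite -pmulrn jp mulrNz addNr.
Qed.

(** Kronecker's theorem with targets alpha_i - k_i * alpha_i + delta / 2: the
    centre delta / 2 of the allowed window makes both bounds strict. *)
Lemma product_factor_exists (R : realType) (d : nat) (alpha : 'I_d -> R)
    (delta : R) (k : 'I_d -> nat) :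
    Z_independent alpha -> 0 < delta ->
  exists (n : nat) (p : 'I_d -> int), forall i,
    0 < (n%:R - 1) * alpha i + (k i)%:R * alpha i - (p i)%:~R < delta.
Proof.
move=> ind delta0; have delta20 : 0 < delta / 2 by rewrite divr_gt0.
have [n [p pP]] := kronecker ind
  (fun i => alpha i - (k i)%:R * alpha i + delta / 2) delta20.
by exists n, p => i; have := pP i; rewrite ltr_norml; lra.
Qed.

Lemma complexity_product_sturmian (R : realType) (d : nat)
    (alpha : 'I_d -> R) (N : nat) :
    Z_independent alpha ->
  subword_complexity (product_word (fun i => sturmian (alpha i))) N
  = (N.+1 ^ d)%N.
Proof.
move=> ind; set a := product_word _.
have cardE : #|{ffun 'I_d -> 'I_N.+1}| = (N.+1 ^ d)%N.
  by rewrite card_ffun !card_ord.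
(* upper bound: the d numbers of jumps determine the factor *)
pose code (n : nat) : {ffun 'I_d -> 'I_N.+1} :=
  [ffun i => inord (\sum_(k < N) jump (alpha i) n k.+1)%N].
have codeP n m : code n = code m -> Defs.factor a N n = Defs.factor a N m.
  move=> eqc; apply/product_factor_eqP => i; apply: eq_height_jumps.
  have /ffunP/(_ i)/(congr1 val) := eqc; rewrite !ffunE /=.
  have lt_sum b : (\sum_(k < N) nat_of_bool (b k) < N.+1)%N.
    rewrite ltnS -[leqRHS]card_ord -sum1_card; apply: leq_sum => k _.
    exact: leq_b1.
  by rewrite !inordK.
have [fin le_card] := card_range_le codeP.
apply/eqP; rewrite eqn_leq -cardE le_card /=.
have [delta [delta0 delta1 gap]] : exists delta : R, [/\ 0 < delta, delta <= 1 &
    forall (ij : 'I_d * 'I_N) (p : int),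
      delta <= `|ij.2.+1%:R * alpha ij.1 - p%:~R|].
  by apply: gap_exists => -[i j] p; apply: Z_independent_multiple.
(* lower bound: a choice of one threshold per coordinate is realised at v f *)
have /choice[v vP] (f : {ffun 'I_d -> 'I_N.+1}) :=
  product_factor_exists (fun i => f i) ind delta0.
apply: (card_range_ge (v := v)) => // f g /product_factor_eqP eqh.
apply/ffunP => i; apply: val_inj.
have [[p /(_ i) vf] [q /(_ i) vg]] := (vP f, vP g).
have gapi (j : nat) (r : int) :
    (0 < j <= N)%N -> delta <= `|j%:R * alpha i - r%:~R|.
  by case: j => [//|j] ltjN; apply: (gap (i, Ordinal ltjN)).
exact: (height_separation gapi delta1 (leq_ord (f i)) (leq_ord (g i)) vf vg
  (eqh i)).
Qed.

(** * The growth exponent *)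

Lemma cvg_ln_pinfty (R : realType) : ln (n%:R : R) @[n --> \oo] --> +oo.
Proof.
apply/cvgryPge => A; have := @cvgr_idn R => /cvgryPge/(_ (expR A)).
apply: filterS => n leA; rewrite -[leLHS]expRK ler_ln ?posrE ?expR_gt0 //.
exact: lt_le_trans (expR_gt0 _) leA.
Qed.

(** From n <= n + 1 <= 2 n the ratio lies between 1 and 1 + ln 2 / ln n. *)
Lemma cvg_ln_succ_ratio (R : realType) :
  ln (n.+1%:R : R) / ln (n%:R : R) @[n --> \oo] --> (1 : R).
Proof.
have n1 : \forall n \near \oo, (1 < n)%N by exists 2%N.
have ln_gt0_near : \forall n \near \oo, 0 < ln (n%:R : R).
  by near=> n; rewrite ln_gt0 // ltr1n; near: n.
apply: (@squeeze_cvgr _ _ _ _ (cst 1) (fun n => 1 + ln 2 * (ln n%:R)^-1)).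
- near=> n; have ln0 : 0 < ln (n%:R : R) by near: n.
  have n0 : (0 < n)%N by apply: (@ltn_trans 1) => //; near: n.
  rewrite ler_pdivlMr // mul1r ler_ln ?posrE ?ltr0n // ler_nat leqnSn /=.
  rewrite ler_pdivrMr // mulrDl mul1r -mulrA mulVf ?gt_eqF // mulr1 addrC.
  rewrite -lnM ?posrE ?ltr0n // -natrM ler_ln ?posrE ?ltr0n ?muln_gt0 //.
  by rewrite ler_nat; lia.
- exact: cvg_cst.
- rewrite -[X in _ --> X]addr0 -[X in _ + X](mulr0 (ln 2)).
  apply: cvgD; first exact: cvg_cst.
  apply: cvgM; first exact: cvg_cst.
  exact: (gtr0_cvgV0 ln_gt0_near).2 (@cvg_ln_pinfty R).
Unshelve. all: by end_near. Qed.

Lemma lambda_eq (R : realType) (T : choiceType) (a : nat -> T) (d : nat) :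
    (forall N, subword_complexity a N = (N.+1 ^ d)%N) ->
  lambda R a = (d%:R)%:E.
Proof.
move=> pE; rewrite /lambda; apply: (cvg_limn_einf_sup _).2.
apply: cvg_EFin; first exact: nearW.
rewrite (_ : _ \o _ = fun N => d%:R * (ln N.+1%:R / ln N%:R)); last first.
  apply/funext => N /=.
  by rewrite pE natrX lnXn ?ltr0n // -[ln _ *+ d]mulr_natl mulrA.
rewrite -[X in _ --> X]mulr1; apply: cvgM; first exact: cvg_cst.
exact: cvg_ln_succ_ratio.
Qed.

(** * Bracket words *)

Lemma GP_sum (R : realType) (I : finType) (c : I -> R) (f : I -> R -> R) :
    (forall i, GP (f i)) -> GP (fun x => \sum_i c i * f i x).
Proof.
move=> gpf; elim: (index_enum I) => [|i r IHr].
  rewrite (_ : (fun=> _) = fun x => (0 : {poly R}).[x]); first exact: GP_poly.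
  by apply/funext => x; rewrite big_nil horner0.
rewrite (_ : (fun=> _) = fun x => (c i)%:P.[x] * f i x
    + \sum_(j <- r) c j * f j x).
  by do 2![apply: GP_add => //; try apply: GP_mul => //; try exact: GP_poly].
by apply/funext => x; rewrite big_cons hornerC.
Qed.

Lemma GP_sturmian (R : realType) (alpha : R) :
  exists2 f : R -> R, GP f & forall n, f n%:R = (sturmian alpha n)%:~R.
Proof.
exists (fun x => (Num.floor (alpha%:P * 'X).[x])%:~R
    + (-1)%:P.[x] * (Num.floor (alpha%:P * ('X - 1%:P)).[x])%:~R).
  apply: GP_add; first exact/GP_floor/GP_poly.
  by apply: GP_mul; [exact: GP_poly | exact/GP_floor/GP_poly].
move=> n; rewrite !hornerE /sturmian intrD mulrNz mulN1r.
by rewrite ![_ * alpha]mulrC.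
Qed.

Lemma finite_range_product_sturmian (R : realType) (d : nat)
    (alpha : 'I_d -> R) :
  finite_set (range (product_word (fun i => sturmian (alpha i)))).
Proof.
(* a letter is a height at k = 1 *)
pose code (n : nat) : {ffun 'I_d -> bool} := [ffun i => jump (alpha i) n 1].
apply: (card_range_le (code := code) _).1 => n m /ffunP eqc.
apply/ffunP => i; have := eqc i; rewrite !ffunE => eqj.
rewrite -(addn0 n) -(addn0 m) !sturmian_height !height0.
by rewrite !height_jump eqj.
Qed.

(** The coefficients alpha_i merge the d integer-valued coordinates into one
    real number without loss: a coincidence of two values would be an integer
    linear relation between the alpha_i. *)
Lemma bracket_product_sturmian (R : realType) (d : nat) (alpha : 'I_d -> R) :
    Z_independent alpha ->
  bracket_word R (product_word (fun i => sturmian (alpha i))).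
Proof.
move=> ind; set a := product_word _.
have fin : finite_set (range a) by exact: finite_range_product_sturmian.
exists (range a) => //.
pose g n : R := \sum_i alpha i * (a n i)%:~R.
have g_inj n m : g n = g m -> a n = a m.
  move=> eqg; apply/ffunP => i; apply/eqP; rewrite -subr_eq0; apply/eqP.
  apply: (ind 0 (fun i => a n i - a m i)); rewrite add0r.
  transitivity (g n - g m); last by rewrite eqg subrr.
  rewrite /g -sumrB; by apply: eq_bigr => j _; rewrite intrB; ring.
pose c x := a (xget 0%N [set n | g n = x]).
have cg n : a n = c (g n).
  by apply/esym/g_inj; apply: (@xgetPex _ 0%N [set m | g m = g n]); exists n.
exists g, c; split => //.
- have /choice[f fP] i : exists f : R -> R, GP f /\
      forall n, f n%:R = (sturmian (alpha i) n)%:~R.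
    by have [f] := GP_sturmian (alpha i); exists f.
  exists (fun x => \sum_i alpha i * f i x).
    by apply: GP_sum => i; have [] := fP i.
  move=> n; apply: eq_bigr => i _; have [_ ->] := fP i.
  by rewrite ffunE.
- apply: sub_finite_set (finite_image
    (fun w : {ffun 'I_d -> int} => \sum_i alpha i * (w i)%:~R) fin).
  by move=> _ [n _ <-]; exists (a n) => //; exists n.
Qed.

(* [oapp alpha 1 : option 'I_d -> R] is the family 1, alpha_1, ..., alpha_d,
   with None indexing the entry 1. *)
Theorem proposition12p2 (R : realType) (d : nat) (hd : (0 < d)%N)
    (alpha : 'I_d -> R)
    (halpha : Q_linearly_independent (oapp alpha 1)) :
  let a := product_word (fun i => sturmian (alpha i)) in
  bracket_word R a /\ lambda R a = (d%:R)%:E.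
Proof.
have ind := Q_independent_Z halpha; split.
  exact: bracket_product_sturmian.
by apply: lambda_eq => N; apply: complexity_product_sturmian.
Qed.
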